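(* Let $G$ be a connected central topological group and let $K$ be a compact normal subgroup of $G$. If $G$ admits a transversal group topology, then $G/K$ (with the quotient topology) admits a transversal group topology.
   Context: Two non-discrete Hausdorff group topologies $\tau,\delta$ on a group $G$ are called transversal if their least upper bound $\tau\vee\delta$ is the discrete topology. A topological group $(G,\tau)$ admits a transversal group topology if there is a group topology $\delta$ on $G$ such that $\tau$ and $\delta$ are transversal (in particular $\tau$ is then non-discrete and Hausdorff). A locally compact topological group $G$ is a central topological group if $G/Z(G)$ is compact, where $Z(G)$ is the center of $G$. *)

(* Defs.v *)
From HB Require Import structures.
From mathcomp Require Import all_boot.
From mathcomp Require Import all_classical.
From mathcomp Require Import topology.

Set Implicit Arguments.
Unset Strict Implicit.
Unset Printing Implicit Defensive.

Local Open Scope classical_set_scope.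
Local Open Scope quotient_scope.
Local Open Scope group_scope.

HB.structure Definition PreTopologicalGroup :=
  {G of Topological G & Group G}.

HB.mixin Record PreTopologicalGroup_isTopologicalGroup G
    & PreTopologicalGroup G := {
  mulg_continuous : continuous (fun p : G * G => p.1 * p.2) ;
  invg_continuous : continuous (fun x : G => x^-1)
}.

(* No separation axiom is part of the structure. *)
#[short(type="topologicalGroupType")]
HB.structure Definition TopologicalGroup :=
  {G of PreTopologicalGroup G & PreTopologicalGroup_isTopologicalGroup G}.

(* Several topologies on one group are handled as in [sup_topology], as elements
   of [Topological G]; the algebraic operations are always those of [G]. *)
Definition group_topology (G : groupType) (t : Topological G) : Prop :=
  let T : topologicalType := Topological.Pack t in
  continuous (fun p : T * T => ((p.1 : G) * (p.2 : G) : T)) /\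
  continuous (fun x : T => ((x : G)^-1 : T)).

Definition discrete_space (T : topologicalType) : Prop :=
  forall A : set T, open A.

Definition join_topology (G : choiceType) (t d : Topological G) :
    topologicalType :=
  sup_topology (fun b : bool => if b then t else d).

Definition nondiscrete_hausdorff_group_topology (G : groupType)
    (t : Topological G) : Prop :=
  [/\ group_topology t, ~ discrete_space (Topological.Pack t)
    & hausdorff_space (Topological.Pack t)].

Definition transversal (G : groupType) (t d : Topological G) : Prop :=
  [/\ nondiscrete_hausdorff_group_topology t,
      nondiscrete_hausdorff_group_topology d
    & discrete_space (join_topology t d)].

Definition admits_transversal_group_topology (G : topologicalGroupType) : Prop :=
  exists d : Topological G, transversal (Topological.class G) d.

Record normalSubgroup (G : groupType) := NormalSubgroup {
  normal_set :> set G ;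
  normal1 : normal_set 1 ;
  normalM : forall x y, normal_set x -> normal_set y -> normal_set (x * y) ;
  normalV : forall x, normal_set x -> normal_set x^-1 ;
  normalJ : forall x y, normal_set x -> normal_set (x ^ y)
}.

Section Center.
Variable G : groupType.

Definition center_set : set G := [set x | forall y, commute x y].

Lemma center1 : center_set 1.
Proof. by move=> y; rewrite /commute mul1g mulg1. Qed.

Lemma centerM x y : center_set x -> center_set y -> center_set (x * y).
Proof. by move=> cx cy z; rewrite /commute -mulgA (cy z) !mulgA (cx z). Qed.

Lemma centerV x : center_set x -> center_set x^-1.
Proof.
move=> cx z; rewrite /commute; apply: (mulgI x).
by rewrite mulgA mulgV mul1g mulgA (cx z) -mulgA mulgV mulg1.
Qed.

Lemma centerJ x y : center_set x -> center_set (x ^ y).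
Proof. by move=> cx; rewrite /conjg (cx y) mulgA mulVg mul1g. Qed.

Definition center : normalSubgroup G :=
  NormalSubgroup center1 centerM centerV centerJ.

End Center.

Section Quotient.
Variables (G : topologicalGroupType) (K : normalSubgroup G).

Definition coset_rel : rel G := fun x y => `[< normal_set K (x^-1 * y) >].

Lemma coset_rel_refl : reflexive coset_rel.
Proof. by move=> x; apply/asboolP; rewrite mulVg; exact: normal1. Qed.

Lemma coset_rel_sym : symmetric coset_rel.
Proof.
by move=> x y; apply/asboolP/asboolP => /normalV; rewrite invgM invgK.
Qed.

Lemma coset_rel_trans : transitive coset_rel.
Proof.
move=> y x z /asboolP xy /asboolP yz; apply/asboolP.
by have := normalM xy yz; rewrite mulgA -(mulgA x^-1) mulgV mulg1.
Qed.

Canonical coset_equiv :=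
  EquivRel coset_rel coset_rel_refl coset_rel_sym coset_rel_trans.

Definition quotient_group : Type :=
  quotient_topology {eq_quot coset_equiv}.

HB.instance Definition _ := Topological.copy quotient_group
  (quotient_topology {eq_quot coset_equiv}).
HB.instance Definition _ := Quotient.copy quotient_group
  (quotient_topology {eq_quot coset_equiv}).

Local Notation Q := quotient_group.
Local Notation piQ := (\pi_Q : G -> Q).

Lemma quotient_groupP x y : piQ x = piQ y <-> normal_set K (x^-1 * y).
Proof.
split=> [exy|Kxy].
  by have /eqmodP/asboolP := exy : x = y %[mod {eq_quot coset_equiv}].
have : x = y %[mod {eq_quot coset_equiv}] by apply/eqmodP/asboolP.
exact.
Qed.

Definition quotient_one : Q := piQ 1.
Definition quotient_mul (a b : Q) : Q := piQ (repr a * repr b).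
Definition quotient_inv (a : Q) : Q := piQ (repr a)^-1.

Lemma quotient_mulE x y : quotient_mul (piQ x) (piQ y) = piQ (x * y).
Proof.
have Kx : normal_set K ((repr (piQ x))^-1 * x) by apply/quotient_groupP; rewrite reprK.
have Ky : normal_set K ((repr (piQ y))^-1 * y) by apply/quotient_groupP; rewrite reprK.
apply/quotient_groupP.
have := normalM Ky (normalJ y Kx).
by rewrite /conjg invgM !mulgA mulgK.
Qed.

Lemma quotient_invE x : quotient_inv (piQ x) = piQ x^-1.
Proof.
have Kx : normal_set K ((repr (piQ x))^-1 * x) by apply/quotient_groupP; rewrite reprK.
apply/quotient_groupP; have := normalJ x^-1 (normalV Kx).
by rewrite /conjg invgM !invgK !mulgA mulgV mul1g.
Qed.

Lemma quotient_mulA : associative quotient_mul.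
Proof.
move=> a b c; rewrite -(reprK a) -(reprK b) -(reprK c).
move: (repr a) (repr b) (repr c) => x y z.
rewrite (quotient_mulE y z) (quotient_mulE x y).
by rewrite (quotient_mulE x (y * z)) (quotient_mulE (x * y) z) mulgA.
Qed.

Lemma quotient_mul1g : left_id quotient_one quotient_mul.
Proof. by move=> a; rewrite -(reprK a) quotient_mulE mul1g. Qed.

Lemma quotient_mulg1 : right_id quotient_one quotient_mul.
Proof. by move=> a; rewrite -(reprK a) quotient_mulE mulg1. Qed.

Lemma quotient_mulVg : left_inverse quotient_one quotient_inv quotient_mul.
Proof.
by move=> a; rewrite -(reprK a) quotient_invE quotient_mulE mulVg.
Qed.

Lemma quotient_mulgV : right_inverse quotient_one quotient_inv quotient_mul.
Proof.
by move=> a; rewrite -(reprK a) quotient_invE quotient_mulE mulgV.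
Qed.

HB.instance Definition _ := isGroup.Build Q
  quotient_mulA quotient_mul1g quotient_mulg1 quotient_mulVg quotient_mulgV.

Lemma pi_mulg x y : piQ (x * y) = piQ x * piQ y.
Proof. by rewrite -quotient_mulE. Qed.

Lemma pi_invg x : piQ x^-1 = (piQ x)^-1.
Proof. by rewrite -quotient_invE. Qed.

Lemma pi_quotient_continuous : continuous piQ.
Proof. exact: pi_continuous. Qed.

Lemma mulgr_continuous (k : G) : continuous (fun x : G => x * k).
Proof.
move=> x; apply: (@continuous_comp _ _ _ (fun x => (x, k))
  (fun p : G * G => p.1 * p.2)); last exact: mulg_continuous.
by apply: cvg_pair => /=; [exact: cvg_id|exact: cvg_cst].
Qed.

Lemma pi_quotient_open (U : set G) : open U -> open (piQ @` U).
Proof.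
move=> oU; rewrite /open/= /quotient_open.
suff -> : piQ @^-1` (piQ @` U) = \bigcup_(k in K) ((fun x => x * k) @^-1` U).
  apply: bigcup_open => k _.
  by have /continuousP := @mulgr_continuous k; apply.
rewrite eqEsubset; split => [x [u Uu /esym/quotient_groupP Kxu]|x [k Kk /= Uxk]].
  by exists (x^-1 * u) => //=; rewrite mulgA mulgV mul1g.
by exists (x * k) => //; apply/esym/quotient_groupP; rewrite mulgA mulVg mul1g.
Qed.

Lemma pi_quotient_nbhs (x : G) (A : set G) : nbhs x A -> nbhs (piQ x) (piQ @` A).
Proof.
rewrite nbhsE => -[B [oB Bx] BA]; rewrite nbhsE.
by exists (piQ @` B); [split; [exact: pi_quotient_open|exists x]|exact: image_subset].
Qed.

Lemma quotient_mulg_continuous : continuous (fun p : Q * Q => p.1 * p.2).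
Proof.
move=> [a b] W /=; rewrite -(reprK a) -(reprK b) -pi_mulg.
set x := repr a; set y := repr b => nW.
have /= := @mulg_continuous G (x, y) _ (@pi_quotient_continuous (x * y) W nW).
case=> -[A B] /= [nA nB] AB.
exists (piQ @` A, piQ @` B) => /=; first by split; exact: pi_quotient_nbhs.
move=> [_ _] [/= [u Au <-] [v Bv <-]].
by have := AB (u, v) (conj Au Bv); rewrite /= pi_mulg.
Qed.

Lemma quotient_invg_continuous : continuous (fun a : Q => a^-1).
Proof.
move=> a W /=; rewrite -(reprK a) -pi_invg; set x := repr a => nW.
have /= nA := @invg_continuous G x _ (@pi_quotient_continuous x^-1 W nW).
apply: filterS (pi_quotient_nbhs nA) => _ [u /= Wu <-].
by rewrite /= -pi_invg.
Qed.

HB.instance Definition _ := PreTopologicalGroup_isTopologicalGroup.Build Q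
  quotient_mulg_continuous quotient_invg_continuous.

End Quotient.

Definition central_topological_group (G : topologicalGroupType) : Prop :=
  locally_compact [set: G] /\ compact [set: quotient_group (center G)].

(* Main.v *)
Require Import Defs.
From HB Require Import structures.
From mathcomp Require Import all_boot all_classical topology.

Local Open Scope classical_set_scope.

(** The theorem holds because, for a connected central group, having a
    transversal group topology amounts to not being compact, and [G] is
    compact as soon as [K] and [G / K] are.

    A compact group has no transversal topology [d]
    ([compact_not_transversal]): transversality gives a neighbourhood [U] of 1
    and a [d]-neighbourhood [V] of 1 meeting only in 1, while by compactness
    points other than 1 that tend to 1 for [d] accumulate for the given
    topology, so that two distinct ones differ by an element of both
    [U] and [V].  Hence [G], and then [Q = G / K] too, is not compact
    ([compact_extension]).

    Conversely let [Q] be connected, locally compact, not compact, and a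
    product [C Z(Q)] with [C] compact.  Some central [z] then has all its
    powers [z ^+ n], [0 < n], outside a fixed neighbourhood of 1
    ([discrete_central_power]).  Otherwise every central [z] has powers
    returning to each neighbourhood of 1, and such powers stay in a compact
    set ([recurrent_powers_precompact]).  For a suitable compact [B] and
    neighbourhood [W] of 1, the compact set [B W] is covered by finitely many
    central translates [B z_i]; so [P B], where [P] is the monoid generated by
    the [z_i], is stable under [W] and by connectedness is all of [Q].  But
    [P] lies in a product of finitely many compact sets, one for each [z_i],
    which would make [Q] compact.

    Finally the cosets of the groups generated by [z ^+ (2 ^ n)] form a base of
    a group topology on [Q]: Hausdorff and non-discrete as [z] has infinite
    order, and transversal to the given one as the group generated by [z] is
    discrete in [Q] ([central_power_transversal]). *)

Set Implicit Arguments.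
Unset Strict Implicit.
Unset Printing Implicit Defensive.

Local Open Scope quotient_scope.
Local Open Scope group_scope.

(** * Neighbourhoods of one in a group topology *)

Lemma mulVg1_eq (G : groupType) (x y : G) : x^-1 * y = 1 -> x = y.
Proof. by move/mulg1_eq; rewrite invgK. Qed.

Section NeighbourhoodsOfOne.
Variables (G : groupType) (t : Topological G).
Let T : topologicalType := Topological.Pack t.
Hypothesis tG : group_topology t.

Lemma nbhs_div (U : set G) : nbhs (1 : T) U ->
  exists2 V : set G, nbhs (1 : T) V & forall a b, V a -> V b -> U (a^-1 * b).
Proof.
case: tG => cM cV nU.
have nU' : nbhs ((1 * 1 : G) : T) U by rewrite mulg1.
have /= := cM ((1 : G) : T, (1 : G) : T) _ nU'.
case=> -[A B] /= [nA nB] AB.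
have nA' : nbhs (((1 : G)^-1) : T) A by rewrite invg1.
have /= nA'' := cV (1 : T) _ nA'.
exists ((fun x : G => x^-1) @^-1` A `&` B); first exact: filterI.
by move=> a b [/= Aa _] [_ Bb]; exact: (AB (a^-1, b)).
Qed.

Lemma nbhs_translate (x : G) (U : set G) : nbhs (1 : T) U ->
  nbhs (x : T) [set y : G | U (x^-1 * y)].
Proof.
case: tG => cM _ nU.
have nU' : nbhs ((x^-1 * x : G) : T) U by rewrite mulVg.
have /= := cM ((x^-1 : G) : T, (x : G) : T) _ nU'.
case=> -[A B] /= [nA nB] AB.
have Ax : A x^-1 by exact: (@nbhs_singleton T _ _ nA).
by apply: filterS nB => y By; exact: (AB (x^-1, y)).
Qed.

Lemma hausdorff_group_topology :
  (forall x : G, x != 1 -> exists2 U : set G, nbhs (1 : T) U & ~ U x) ->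
  hausdorff_space T.
Proof.
move=> sep p q pq; apply: contrapT => npq.
have [|U nU nUx] := sep ((p : G)^-1 * q).
  by apply/eqP => /mulVg1_eq.
have [V nV VU] := nbhs_div nU.
have [W nW WV] := nbhs_div nV.
(* A common point y of p W and q W gives p^-1 q = (p^-1 y) (q^-1 y)^-1, a
   quotient on the other side than the one nbhs_div controls; hence the
   inverses of W are needed inside V. *)
have W1 : W 1 by exact: nbhs_singleton nW.
have WVi a : W a -> V a^-1 by move=> Wa; rewrite -(mulg1 a^-1); exact: WV.
have [y [/= Wpy Wqy]] := pq _ _ (nbhs_translate p nW) (nbhs_translate q nW).
apply: nUx; have := VU _ _ (WVi _ Wpy) (WVi _ Wqy).
by rewrite invgK invgM invgK mulgA mulgK.
Qed.

End NeighbourhoodsOfOne.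

(** Translating by group elements turns discreteness of a join into one
    separation at 1.  The join is reached through its convergent filters: the
    filter spanned by the sets [U `&` V] converges to 1 in both topologies,
    hence in the join. *)
Lemma discrete_joinP (G : groupType) (t d : Topological G) :
  group_topology t -> group_topology d ->
  discrete_space (join_topology t d) <->
  exists U V : set G, [/\ nbhs (1 : Topological.Pack t) U,
    nbhs (1 : Topological.Pack d) V & forall x, U x -> V x -> x = 1].
Proof.
move=> tG dG; split=> [disc|[U [V [nU nV UV]]]].
  pose F := filter_from
    [set p : set G * set G | nbhs (1 : Topological.Pack t) p.1 /\
                             nbhs (1 : Topological.Pack d) p.2]
    (fun p => p.1 `&` p.2).
  have FF : Filter F.
    apply: filter_from_filter.
      by exists (setT, setT); split; exact: filterT.
    move=> [A B] [A' B'] /= [nA nB] [nA' nB'].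
    exists (A `&` A', B `&` B') => /=.
      by split; exact: filterI.
    by rewrite setIACA.
  have F1 : F --> (1 : join_topology t d).
    apply/cvg_sup => -[] A nA.
      by exists (A, setT); [split => //; exact: filterT|move=> x []].
    by exists (setT, A); [split => //; exact: filterT|move=> x []].
  have n1 : nbhs (1 : join_topology t d) [set 1 : G].
    have o1 : open ([set 1 : G] : set (join_topology t d)) by exact: disc.
    exact: open_nbhs_nbhs.
  have [[A B] /= [nA nB] AB] := F1 _ n1.
  by exists A, B; split => // x Ax Bx; exact: AB.
move=> A; rewrite openE => x Ax; rewrite /interior.
have /cvg_sup nxb :
  nbhs (x : join_topology t d) --> (x : join_topology t d) by exact: cvg_id.
have xU := nxb true _ (nbhs_translate tG x nU).
have xV := nxb false _ (nbhs_translate dG x nV).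
apply: filterS (filterI xU xV) => y /= [Uy Vy].
by have /mulVg1_eq <- := UV _ Uy Vy.
Qed.

Lemma topological_group_topology (G : topologicalGroupType) :
  group_topology (Topological.class G).
Proof. by split; [exact: mulg_continuous|exact: invg_continuous]. Qed.

(** The punctured [d]-neighbourhoods of 1 form a proper filter, which clusters
    at some [p] for the compact topology.  The translate of a small
    neighbourhood by [p] then contains two distinct points [d]-close to 1; the
    second is found by removing the first from the [d]-neighbourhood. *)
Lemma compact_not_transversal (G : topologicalGroupType) (d : Topological G) :
  compact [set: G] -> ~ Defs.transversal (Topological.class G) d.
Proof.
move=> cG [[tG _ _] [dG ndisc hd] /(discrete_joinP tG dG) [U [V [nU nV UV]]]].
have [U1 nU1 U1U] := nbhs_div tG nU.
have [V1 nV1 V1V] := nbhs_div dG nV.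
pose D : topologicalType := Topological.Pack d.
have n1 (x : G) (A : set G) : nbhs (1 : D) A -> x != 1 ->
    nbhs (1 : D) (A `\ x).
  move=> nA x1; apply: filterI => //.
  have ox : open (~` [set x : D]).
    apply: closed_openC.
    exact: (accessible_closed_set1 (hausdorff_accessible hd)).
  by apply: open_nbhs_nbhs; split => //= e; rewrite e eqxx in x1.
pose F := filter_from [set A : set G | nbhs (1 : D) A] (fun A => A `\ 1).
have FF : ProperFilter F.
  apply: filter_from_proper.
    apply: filter_from_filter; first by exists setT; exact: filterT.
    by move=> A B nA nB; exists (A `&` B); [exact: filterI|move=> x [[? ?] ?]].
  move=> A nA; apply: contrapT => A0; apply: ndisc => B.
  rewrite openE => x Bx; rewrite /interior.
  apply: filterS (nbhs_translate dG x nA) => y /= Ay.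
  have /mulVg1_eq <- // : x^-1 * y = 1.
  by apply: contrapT => e; apply: A0; exists (x^-1 * y).
have [p [_ clp]] := cG F FF filterT.
have np := nbhs_translate tG p nU1.
have meet (A : set G) : nbhs (1 : D) A ->
    exists x, [/\ A x, x != 1 & U1 (p^-1 * x)].
  move=> nA; have FA : F (A `\ 1) by exists A.
  by have [x [/= [Ax x1] Ux]] := clp _ _ FA np; exists x; split=> //;
    apply/eqP.
have [x [Vx x1 Ux]] := meet _ nV1.
have [y [[Vy yx] _ Uy]] := meet _ (n1 _ _ nV1 x1).
apply: yx => /=.
have := UV (x^-1 * y) _ (V1V _ _ Vx Vy).
have := U1U _ _ Ux Uy; rewrite invgM invgK mulgA mulgK => /[swap] /[apply].
by move/mulVg1_eq.
Qed.

(** * Compactness in topological groups *)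

(** A near covering argument whose directed parameter is the finite subfamily. *)
Lemma compact_finite_cover (T : topologicalType) (I : eqType) (A : set T)
    (D : set I) (f : I -> set T) :
  compact A -> (forall x, A x -> exists2 i, D i & nbhs x (f i)) ->
  exists2 s : seq I, (forall i, i \in s -> D i)
    & forall x, A x -> exists2 i, i \in s & f i x.
Proof.
move=> /compact_near_coveringP cA cov.
pose F := filter_from [set s : seq I | forall i, i \in s -> D i]
  (fun s => [set r : seq I | {subset s <= r} /\ forall i, i \in r -> D i]).
have FF : Filter F.
  apply: filter_from_filter; first by exists [::].
  move=> s r Ds Dr; exists (s ++ r) => /=.
    by move=> i; rewrite mem_cat => /orP[/Ds|/Dr].
  by move=> q [/= sq Dq]; split; split=> // i iq; apply: sq;
     rewrite mem_cat iq ?orbT.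
have [] := cA _ F (fun r x => exists2 i, i \in r & f i x) FF.
  move=> x /cov [i Di nfi].
  exists (f i, [set r | i \in r]) => /=.
    split=> //; exists [:: i] => [j /=|r [/= ir _]].
      by rewrite mem_seq1 => /eqP ->.
    by apply: ir; rewrite mem_head.
  by move=> [y r] /= [fy ir]; exists i.
move=> s Ds sA; exists s => // x Ax.
by apply: (sA s) => //; split.
Qed.

Section TopologicalGroups.
Variable G : topologicalGroupType.
Implicit Types (A B C U V W : set G) (x y z : G).

Let tG := topological_group_topology G.

Lemma mulgl_continuous x : continuous (fun y : G => x * y).
Proof.
move=> y; apply: (@continuous_comp _ _ _ (fun y => (x, y))
  (fun p : G * G => p.1 * p.2)); last exact: mulg_continuous.
by apply: cvg_pair => /=; [exact: cvg_cst|exact: cvg_id].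
Qed.

Lemma expg_continuous n : continuous (fun x : G => x ^+ n).
Proof.
elim: n => [|n IH] x; first exact: cvg_cst.
rewrite (_ : (fun x => _) = fun x => x * x ^+ n); last first.
  by apply/funext => y; rewrite expgS.
apply: (@continuous_comp _ _ _ (fun x : G => (x, x ^+ n))
  (fun p : G * G => p.1 * p.2)); last exact: mulg_continuous.
by apply: cvg_pair => /=; [exact: cvg_id|exact: IH].
Qed.

Lemma compact_mulset A B : compact A -> compact B ->
  compact [set a * b | a in A & b in B].
Proof.
move=> cA cB.
have -> : [set a * b | a in A & b in B] =
    (fun p : G * G => p.1 * p.2) @` (A `*` B).
  apply/seteqP; split=> [_ [a Aa [b Bb <-]]|_ [[a b] [/= Aa Bb] <-]].
    by exists (a, b).
  by exists a => //; exists b.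
apply: continuous_compact; last exact: compact_setX.
by apply: continuous_subspaceT; exact: mulg_continuous.
Qed.

Lemma compact_seq (s : seq G) : compact [set` s].
Proof. by apply: finite_compact; exact: finite_seq. Qed.

Lemma locally_compact_nbhs1 : locally_compact [set: G] ->
  exists2 W : set G, nbhs (1 : G) W & compact W.
Proof.
move=> /(_ 1 I) [W]; rewrite withinET => nW [cW _].
by exists W.
Qed.

(** The projection is open, so images of finitely many translates of a compact
    neighbourhood of 1 cover the quotient. *)
Lemma compact_quotient_lift (N : normalSubgroup G) :
  locally_compact [set: G] -> compact [set: quotient_group N] ->
  exists2 C : set G, compact C
    & forall x, exists c n, [/\ C c, normal_set N n & x = c * n].
Proof.
move=> /locally_compact_nbhs1 [W nW cW] cQ.
pose Q := quotient_group N.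
have [|s _ sQ] := @compact_finite_cover Q G setT setT
    (fun x => (\pi_Q : G -> Q) @` [set y | W (x^-1 * y)]) cQ.
  move=> q _; exists (repr q) => //; rewrite -{1}(reprK q).
  exact: (pi_quotient_nbhs _ (nbhs_translate tG (repr q) nW)).
exists [set a * b | a in [set` s] & b in W].
  by apply: compact_mulset => //; exact: compact_seq.
move=> x; have [y ys [w /= Ww /quotient_groupP Nwx]] := sQ (\pi_Q x) I.
exists w, (w^-1 * x); split=> //; last by rewrite mulgA mulgV mul1g.
by exists y => //; exists (y^-1 * w) => //; rewrite mulgA mulgV mul1g.
Qed.

(** Such a set is open, and closed because a point adherent to it is reached
    from one of its points by a small right translation. *)
Lemma connected_right_stable A W : connected [set: G] -> nbhs (1 : G) W ->
  A !=set0 -> (forall a w, A a -> W w -> A (a * w)) -> A = setT.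
Proof.
move=> cG nW A0 AW.
have [V nV VW] := nbhs_div tG nW.
have nV1 : nbhs (1 : G) (V `&` W) by exact: filterI.
apply: cG => //; exists A; rewrite ?setTI //.
  rewrite openE => a Aa; apply: filterS (nbhs_translate tG a nW) => y /= Wy.
  by rewrite -(mulKg a^-1 y) invgK; exact: AW.
rewrite -(setCK A); apply: open_closedC; rewrite openE => x nAx.
apply: filterS (nbhs_translate tG x nV) => y /= Vy Ay; apply: nAx.
have -> : x = y * ((x^-1 * y)^-1 * 1).
  by rewrite mulg1 invgM invgK mulgA mulgV mul1g.
by apply: AW => //; apply: VW => //; exact: nbhs_singleton nV.
Qed.

(** Returns occur arbitrarily late, since the map [x |-> x ^+ M.+1] is
    continuous and fixes 1. *)
Lemma recurrent_powers z M V :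
  (forall U : set G, nbhs (1 : G) U -> exists n, U (z ^+ n.+1)) ->
  nbhs (1 : G) V -> exists2 m, M < m & V (z ^+ m).
Proof.
move=> rec nV.
have nV' : nbhs (1 ^+ M.+1 : G) V by rewrite expg1n.
have [n] := rec _ (expg_continuous nV'); rewrite /= -expgnA => Vn.
by exists (n.+1 * M.+1)%N => //; rewrite mulSn leq_addr.
Qed.

(** Half of Weil's dichotomy for monothetic groups.  The exponents at which the
    powers of [z] visit [W] have bounded gaps: [W] meets finitely many small
    translates, each represented by some [z ^+ k x], and a late return
    [z ^+ m] to 1 gives, at any visit [n], a visit [n + (m - k x)].  Every power
    is thus in [z ^+ r * W] with [r < m]. *)
Lemma recurrent_powers_precompact z W : nbhs (1 : G) W -> compact W ->
  (forall U : set G, nbhs (1 : G) U -> exists n, U (z ^+ n.+1)) ->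
  exists2 C : set G, compact C & forall n, C (z ^+ n).
Proof.
move=> nW cW rec.
have [V1 nV1 V1W] := nbhs_div tG nW.
have [V nV VV1] := nbhs_div tG nV1.
have [|s _ sW] := @compact_finite_cover G G W setT
    (fun x => [set y | V (x^-1 * y)]) cW.
  by move=> x _; exists x => //; exact: (nbhs_translate tG x nV).
have /choice [k kP] : forall x, exists k, forall n,
    V (x^-1 * z ^+ n) -> V (x^-1 * z ^+ k).
  move=> x; have [[n Vn]|nV'] := pselect (exists n, V (x^-1 * z ^+ n)).
    by exists n.
  by exists 0 => n Vn; case: nV'; exists n.
have [m mk V1m] := recurrent_powers (\max_(x <- s) k x) rec nV1.
have step n : W (z ^+ n) -> exists2 j, 0 < j <= m & W (z ^+ (n + j)).
  move=> /sW [x xs Vx]; have kx : k x < m.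
    by apply: leq_ltn_trans mk; exact: leq_bigmax_seq.
  exists (m - k x); first by rewrite subn_gt0 kx leq_subr.
  have := V1W _ _ (VV1 _ _ Vx (kP _ _ Vx)) V1m.
  rewrite !invgM !invgK -!mulgA mulVKg -expgnDr addnBA 1?ltnW // expgnFr.
    by rewrite (commuteV (commuteX2 (n + m) (k x) (commute_refl z))).
  by apply: leq_trans (ltnW kx) _; exact: leq_addl.
have gap n : exists i, [/\ i <= n, n < i + m & W (z ^+ i)].
  elim: n => [|n [i [ni im Wi]]].
    by exists 0; split=> //; [exact: leq_ltn_trans mk|exact: nbhs_singleton nW].
  have [lt|ge] := ltnP n.+1 (i + m); first by exists i; split=> //; exact: ltnW.
  have [j /andP[j0 jm] Wj] := step _ Wi; exists (i + j); split=> //.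
    by apply: leq_trans ge; rewrite leq_add2l.
  rewrite -addnA; apply: leq_trans (_ : i + m < _) => //.
  by rewrite ltn_add2l -[X in X < _]add0n ltn_add2r.
exists [set a * b | a in [set` [seq z ^+ r | r <- iota 0 m]] & b in W].
  by apply: compact_mulset => //; exact: compact_seq.
move=> n; have [i [ni im Wi]] := gap n.
exists (z ^+ (n - i)); last by exists (z ^+ i) => //; rewrite -expgnDr subnK.
by apply/mapP; exists (n - i) => //; rewrite mem_iota /= ltn_subLR.
Qed.

(** As the generators commute, the monoid they generate is the product of their
    sets of powers. *)
Lemma monoid_of_bounded_powers (s : seq G) :
  (forall z, z \in s -> center_set z /\
     exists2 C : set G, compact C & forall n, C (z ^+ n)) ->
  exists P : set G, [/\ P 1, forall p z, P p -> z \in s -> P (p * z)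
    & exists2 C : set G, compact C & P `<=` C].
Proof.
elim: s => [_|z s IH zs].
  by exists [set 1]; split=> //; exists [set 1] => //; exact: compact_set1.
have [|P [P1 PM [C cC PC]]] := IH.
  by move=> y ys; apply: zs; rewrite inE ys orbT.
have [zc [D cD Dz]] := zs z (mem_head z s).
exists [set a * b | a in range (fun n => z ^+ n) & b in P]; split.
- by exists 1; [exists 0|exists 1; rewrite ?mulg1].
- move=> _ y [_ [n _ <-] [p Pp <-]]; rewrite inE => /predU1P[->|ys].
    exists (z ^+ n.+1); first by exists n.+1.
    by exists p => //; rewrite expgSr -!mulgA (zc p).
  exists (z ^+ n); first by exists n.
  by exists (p * y); [exact: PM|rewrite mulgA].
- exists [set a * b | a in D & b in C]; first exact: compact_mulset.
  move=> _ [_ [n _ <-] [p Pp <-]]; exists (z ^+ n) => //.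
  by exists p => //; exact: PC.
Qed.

(** By Weil's dichotomy, if no such [z] exists then every central element has
    precompact powers.  A compact set covering the group up to the center then
    makes the group a product of a compact set and finitely many precompact
    cyclic monoids. *)
Lemma discrete_central_power C : connected [set: G] ->
  locally_compact [set: G] -> ~ compact [set: G] -> compact C ->
  (forall x, exists c z, [/\ C c, center_set z & x = c * z]) ->
  exists z V, [/\ center_set z, nbhs (1 : G) V & forall n, ~ V (z ^+ n.+1)].
Proof.
move=> conG /locally_compact_nbhs1 [W nW cW] ncG cC CZ.
apply: contrapT => no.
have bounded z : center_set z ->
    exists2 D : set G, compact D & forall n, D (z ^+ n).
  move=> cz; apply: (recurrent_powers_precompact nW cW) => U nU.
  apply: contrapT => nUz; apply: no; exists z, U; split=> // n Un.
  by apply: nUz; exists n.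
(* Thickening C by W makes the central translates of B have interiors that
   cover the group. *)
pose B := [set a * b | a in C & b in W].
have cB : compact B by exact: compact_mulset.
have cBW : compact [set a * b | a in B & b in W] by exact: compact_mulset.
have [|s sZ sB] := @compact_finite_cover G G _ (@center_set G)
    (fun z => [set y | B (y * z^-1)]) cBW.
  move=> x _; have [c [z [Cc Zz ->]]] := CZ x; exists z => //.
  apply: filterS (nbhs_translate tG (c * z) nW) => y /= Wy.
  exists c => //; exists ((c * z)^-1 * y) => //.
  by rewrite invgM -mulgA (centerV Zz (c^-1 * y)) -mulgA mulVKg.
have [z /sZ Zz|P [P1 PM [D cD PD]]] := @monoid_of_bounded_powers s.
  by split=> //; exact: bounded.
apply: ncG; suff <- : [set a * b | a in D & b in B] = setT.
  exact: compact_mulset.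
(* The monoid P is put on the left: then right multiplication by W acts on B
   and the central factor that appears moves over to P. *)
suff PB : [set a * b | a in P & b in B] = setT.
  apply/seteqP; split=> // x _.
  have [p Pp [b Bb <-]] : [set a * b | a in P & b in B] x by rewrite PB.
  by exists p; [exact: PD|exists b].
apply: (connected_right_stable conG nW).
  have [c [z [Cc _ _]]] := CZ 1; exists (1 * (c * 1)).
  by exists 1 => //; exists (c * 1) => //; exists c => //; exists 1 => //;
    exact: nbhs_singleton nW.
move=> _ w [p Pp [b Bb <-]] Ww.
have [|z zs /= Bz] := sB (b * w); first by exists b => //; exists w.
exists (p * z); first exact: PM.
exists (b * w * z^-1) => //.
by rewrite -mulgA (sZ _ zs) -mulgA mulVg mulg1 mulgA.
Qed.

End TopologicalGroups.

(** * The topology with a base of cosets *)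

Section CosetTopology.
Variables (G : groupType) (H : nat -> normalSubgroup G).
Hypothesis H_decr : forall m n, m <= n -> (H n : set G) `<=` H m.

Definition coset_open (A : set G) :=
  forall x, A x -> exists n, forall h, normal_set (H n) h -> A (x * h).

Lemma coset_openT : coset_open setT.
Proof. by move=> x _; exists 0. Qed.

Lemma coset_openI : setI_closed coset_open.
Proof.
move=> A B oA oB x [/oA [m Am] /oB [n Bn]]; exists (maxn m n) => h Hh.
by split; [apply: Am|apply: Bn]; apply: H_decr Hh; rewrite ?leq_maxl ?leq_maxr.
Qed.

Lemma coset_open_bigcup (I : Type) (f : I -> set G) :
  (forall i, coset_open (f i)) -> coset_open (\bigcup_i f i).
Proof. by move=> of_ x [i _ /of_ [n fn]]; exists n => h /fn; exists i. Qed.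

Definition coset_topology : Topological G :=
  Topological.class (HB.pack_for topologicalType (G : Type) (Choice.class G)
    (isOpenTopological.Build G coset_openT coset_openI coset_open_bigcup)).

Local Notation coset_space := (Topological.Pack coset_topology).

Lemma nbhs_coset (x : coset_space) (A : set G) :
  nbhs x A <-> exists n, forall h, normal_set (H n) h -> A ((x : G) * h).
Proof.
rewrite nbhsE; split=> [[B [oB Bx] BA]|[n An]].
  by have [n Bn] := oB _ Bx; exists n => h /Bn /BA.
exists [set y : G | normal_set (H n) ((x : G)^-1 * y)].
  split; last by rewrite /= mulVg; exact: normal1.
  rewrite /open/= => y /= Hy.
  by exists n => h Hh /=; rewrite mulgA; exact: normalM.
by move=> y /= /An; rewrite mulgA mulgV mul1g.
Qed.

Lemma coset_group_topology : group_topology coset_topology.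
Proof.
split=> [[x y] A /nbhs_coset [n An]|x A /nbhs_coset [n An]].
  exists ([set u : G | normal_set (H n) ((x : G)^-1 * u)],
          [set u : G | normal_set (H n) ((y : G)^-1 * u)]).
    by split; apply/nbhs_coset; exists n => h /=; rewrite mulgA mulVg mul1g.
  move=> [u v] [/= Hu Hv] /=.
  have := An _ (normalM (normalJ y Hu) Hv); rewrite /conjg !mulgA.
  by rewrite -(mulgA x) mulgV mulg1 mulgV mul1g mulgK.
apply/nbhs_coset; exists n => h Hh /=.
have := An _ (normalJ (x : G)^-1 (normalV Hh)).
by rewrite /conjg /= invgM invgK !mulgA mulVg mul1g.
Qed.

Lemma coset_not_discrete : (forall n, exists2 h, normal_set (H n) h & h <> 1) ->
  ~ discrete_space coset_space.
Proof.
move=> ntH disc.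
have [n Hn] : exists n, forall h, normal_set (H n) h -> [set 1 : G] (1 * h).
  exact: (disc [set 1]).
by have [h /Hn] := ntH n; rewrite /= mul1g.
Qed.

Lemma coset_hausdorff : (forall x, (forall n, normal_set (H n) x) -> x = 1) ->
  hausdorff_space coset_space.
Proof.
move=> capH; apply: (hausdorff_group_topology coset_group_topology) => x x1.
have [n nHx] : exists n, ~ normal_set (H n) x.
  by apply/existsNP => Hx; move: x1; rewrite (capH _ Hx) eqxx.
exists (H n : set G) => //; apply/nbhs_coset; exists n => h.
by rewrite mul1g.
Qed.

End CosetTopology.

(** * Topologies transversal to a discrete central cyclic subgroup *)

Section CentralCycle.
Variables (G : groupType) (z : G).
Hypothesis zc : center_set z.

(** Pairs of natural exponents make products free of case distinctions on
    signs. *)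
Definition cycle_set : set G :=
  [set x | exists a b : nat, x = z ^+ a * z ^- b].

Lemma cycle1 : cycle_set 1.
Proof. by exists 0, 0; rewrite mulgV. Qed.

Lemma cycleM x y : cycle_set x -> cycle_set y -> cycle_set (x * y).
Proof.
move=> [a [b ->]] [c [d ->]]; exists (a + c), (b + d).
rewrite (addnC b) !expgnDr invgM -!mulgA; congr (_ * _).
by rewrite !mulgA; congr (_ * _); apply/esym/commuteV/commuteX2.
Qed.

Lemma cycleV x : cycle_set x -> cycle_set x^-1.
Proof. by move=> [a [b ->]]; exists b, a; rewrite invgM invgK. Qed.

Lemma cycleJ x y : cycle_set x -> cycle_set (x ^ y).
Proof.
move=> [a [b ->]]; exists a, b; rewrite /conjg.
suff -> : commute (z ^+ a * z ^- b) y by rewrite mulKg.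
apply/commute_sym/commuteM; last apply: commuteV;
  by apply: commuteX; apply: commute_sym; exact: zc.
Qed.

Definition central_cycle := NormalSubgroup cycle1 cycleM cycleV cycleJ.

End CentralCycle.

Lemma expg_div_eq (G : groupType) (z : G) a b c d :
  z ^+ a * z ^- b = z ^+ c * z ^- d -> z ^+ (a + d) = z ^+ (c + b).
Proof.
move=> e; rewrite expgnDr -(mulgVK (z ^+ b) (z ^+ a)) e -!mulgA.
by rewrite -expgnDr addnC expgnDr mulKg expgnDr.
Qed.

Lemma centerX (G : groupType) (z : G) n : center_set z -> center_set (z ^+ n).
Proof. by move=> zc y; apply/commute_sym/commuteX/commute_sym/zc. Qed.

(** The group generated by [z] is infinite cyclic; it gets its 2-adic topology
    and is declared open in [G]. *)
Lemma central_power_transversal (G : topologicalGroupType) (z : G) (V : set G) :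
  nondiscrete_hausdorff_group_topology (Topological.class G) ->
  center_set z -> nbhs (1 : G) V -> (forall n, ~ V (z ^+ n.+1)) ->
  admits_transversal_group_topology G.
Proof.
move=> ndh zc nV Vz.
have tG := topological_group_topology G.
have Vdiff i j : i < j -> ~ V (z ^+ j * z ^- i).
  by move=> ij; rewrite -expgnFr 1?ltnW // -[j - i]prednK ?subn_gt0.
have expz_inj i j : z ^+ i = z ^+ j -> i = j.
  wlog ij : i j / i <= j => [wl e|].
    have [ij|/ltnW ji] := leqP i j; first exact: wl.
    by apply/esym/wl.
  move=> e; apply/eqP; rewrite eqn_leq ij leqNgt; apply/negP => lt.
  apply: (Vdiff i j lt); rewrite e mulgV.
  exact: nbhs_singleton nV.
pose H n := central_cycle (centerX (2 ^ n) zc).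
have Hdecr m n : m <= n -> (H n : set G) `<=` H m.
  move=> mn _ [a [b ->]]; exists (2 ^ (n - m) * a)%N, (2 ^ (n - m) * b)%N.
  by rewrite -!expgnA !mulnA -!expnD subnKC.
have capH x : (forall n, normal_set (H n) x) -> x = 1.
  move=> Hx; have [a [b xE]] := Hx 0; rewrite expn0 expg1 in xE.
  suff ab : a = b by rewrite xE ab mulgV.
  (* 2 ^ maxn a b exceeds both a and b, so that congruent means equal *)
  have [c [d]] := Hx (maxn a b); rewrite xE -!expgnA.
  move=> /expg_div_eq/expz_inj/(congr1 (modn^~ (2 ^ maxn a b)%N)).
  rewrite addnC ![(2 ^ _ * _)%N]mulnC !modnMDl !modn_small //.
    by apply: leq_ltn_trans (ltn_expl _ (leqnn 2)); exact: leq_maxr.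
  by apply: leq_ltn_trans (ltn_expl _ (leqnn 2)); exact: leq_maxl.
exists (coset_topology Hdecr); split=> //.
  split; first exact: coset_group_topology.
    apply: coset_not_discrete => n; exists (z ^+ (2 ^ n)).
      by exists 1%N, 0; rewrite expg1 expg0 invg1 mulg1.
    by rewrite -(expg0 z) => /expz_inj/eqP; rewrite expn_eq0.
  exact: coset_hausdorff.
have [U nU UV] := nbhs_div tG nV.
have U1 : U 1 by exact: nbhs_singleton nU.
apply/discrete_joinP => //; first exact: coset_group_topology.
exists U, (H 0 : set G); split=> //.
  by apply/nbhs_coset; exists 0 => h; rewrite mul1g.
move=> x Ux [a [b xE]]; move: Ux; rewrite xE expn0 expg1 => Ux.
have [lt|lt|-> //] := ltngtP a b; last by rewrite mulgV.
  by have := UV _ _ Ux U1; rewrite mulg1 invgM invgK => /(Vdiff _ _ lt).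
by have := UV _ _ U1 Ux; rewrite invg1 mul1g => /(Vdiff _ _ lt).
Qed.

(** * Quotients of topological groups *)

Section QuotientGroup.
Variables (G : topologicalGroupType) (K : normalSubgroup G).
Local Notation Q := (quotient_group K).
Local Notation pi := (\pi_Q : G -> Q).

Lemma image_pi : pi @` setT = setT.
Proof.
by apply/seteqP; split=> // q _; exists (repr q) => //; exact: reprK.
Qed.

Lemma quotient_connected : connected [set: G] -> connected [set: Q].
Proof.
move=> cG; rewrite -image_pi; apply: connected_continuous_connected => //.
by apply: continuous_subspaceT; exact: pi_quotient_continuous.
Qed.

Lemma quotient_hausdorff : closed (K : set G) -> hausdorff_space Q.
Proof.
move=> /closed_openC oK.
apply: (hausdorff_group_topology (topological_group_topology Q)) => q q1.
have [x piq] : exists x, pi x = q by exists (repr q); exact: reprK.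
have nKx : ~ normal_set K (x^-1 * 1).
  by move=> /quotient_groupP e; move: q1; rewrite -piq e eqxx.
exists (pi @` [set y | ~ normal_set K (x^-1 * y)]).
  apply: (@pi_quotient_nbhs G K 1).
  have nK : nbhs (x^-1 * 1) (~` (K : set G)) by exact: open_nbhs_nbhs.
  exact: (mulgl_continuous nK).
by rewrite -piq => -[y /= nKy /esym/quotient_groupP].
Qed.

(** Local compactness asks for closed compact neighbourhoods, hence the
    Hausdorff hypothesis. *)
Lemma quotient_locally_compact : locally_compact [set: G] ->
  hausdorff_space Q -> locally_compact [set: Q].
Proof.
move=> /locally_compact_nbhs1 [W nW cW] hQ q _.
pose B := pi @` [set y | W ((repr q)^-1 * y)].
have cB : compact B.
  apply: continuous_compact.
    by apply: continuous_subspaceT; exact: pi_quotient_continuous.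
  have -> : [set y | W ((repr q)^-1 * y)] = (fun y => repr q * y) @` W.
    apply/seteqP; split=> [y /= Wy|_ [y Wy <-] /=]; last by rewrite mulKg.
    by exists ((repr q)^-1 * y); rewrite ?mulVKg.
  apply: continuous_compact => //.
  by apply: continuous_subspaceT; exact: mulgl_continuous.
exists B; last by split=> //; exact: compact_closed.
rewrite withinET -{1}(reprK q); apply: (pi_quotient_nbhs K).
exact: (nbhs_translate (topological_group_topology G)).
Qed.

Lemma compact_extension : locally_compact [set: G] -> compact (K : set G) ->
  compact [set: Q] -> compact [set: G].
Proof.
move=> lcG cK /(compact_quotient_lift lcG)[C cC CK].
suff <- : [set a * b | a in C & b in K] = setT by exact: compact_mulset.
apply/seteqP; split=> // x _; have [c [k [Cc Kk ->]]] := CK x.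
by exists c => //; exists k.
Qed.

Lemma pi_center z : center_set z -> center_set (pi z).
Proof.
move=> zc q; rewrite -(reprK q) /commute.
by rewrite -[LHS](pi_mulg K) -[RHS](pi_mulg K) (zc (repr q)).
Qed.

End QuotientGroup.

Lemma connected_discrete_compact (T : topologicalType) (x : T) :
  connected [set: T] -> discrete_space T -> compact [set: T].
Proof.
move=> cT disc; rewrite -(_ : [set x] = setT); first exact: compact_set1.
apply: cT; first by exists x.
  by exists [set x]; rewrite ?setTI //; exact: disc.
exists [set x]; rewrite ?setTI // -[X in closed X]setCK.
by apply: open_closedC; exact: disc.
Qed.

(** * Transversal topologies and compact normal subgroups *)

Theorem theorem5p3 (G : topologicalGroupType) (K : normalSubgroup G) :
  connected [set: G] ->
  central_topological_group G ->
  compact (K : set G) ->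
  admits_transversal_group_topology G ->
  admits_transversal_group_topology (quotient_group K).
Proof.
move=> conG [lcG cGZ] cK [d dtrans].
have [[_ _ hG] _ _] := dtrans.
pose Q := quotient_group K; pose pi := \pi_Q : G -> Q.
have conQ : connected [set: Q] by exact: quotient_connected.
have ncQ : ~ compact [set: Q].
  move=> /(compact_extension lcG cK) cG.
  exact: compact_not_transversal cG dtrans.
have hQ : hausdorff_space Q by apply: quotient_hausdorff; exact: compact_closed.
have lcQ : locally_compact [set: Q] by exact: quotient_locally_compact.
have [C cC CZ] := compact_quotient_lift lcG cGZ.
have [|q|z [V [zc nV Vz]]] := @discrete_central_power Q (pi @` C) conQ lcQ ncQ.
- apply: continuous_compact => //.
  by apply: continuous_subspaceT; exact: pi_quotient_continuous.
- have [c [z [Cc zc e]]] := CZ (repr q); exists (pi c), (pi z).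
  split; [by exists c|exact: pi_center|].
  by rewrite -[RHS](pi_mulg K) -e; apply/esym; exact: reprK.
have ndhQ : nondiscrete_hausdorff_group_topology (Topological.class Q).
  split=> //; first exact: topological_group_topology.
  by move=> /(connected_discrete_compact 1 conQ).
exact: central_power_transversal ndhQ zc nV Vz.
Qed.
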